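(* Let $q>9$ be a power of an odd prime and let $X$ be a primitive quandle with $\operatorname{Inn}(X)=\mathrm{PSL}(2,q)$ (as abstract groups, up to isomorphism). Then either (i) $q\equiv 1\pmod 4$, $|X|=q(q+1)/2$ and $X\cong\operatorname{Conj}(\mathrm{PSL}(2,q),\mathcal{C}_5)$, where $\mathcal{C}_5$ is the conjugacy class in $\mathrm{PSL}(2,q)$ of the image of $\begin{pmatrix} i&0\\0&-i\end{pmatrix}$, with $i\in\mathbb{F}_q$, $i^2=-1$; or (ii) $q\equiv 3\pmod 4$, $|X|=q(q-1)/2$ and $X\cong\operatorname{Conj}(\mathrm{PSL}(2,q),\mathcal{C}_5)$, where $\mathcal{C}_5$ is the conjugacy class in $\mathrm{PSL}(2,q)$ of the image of $\begin{pmatrix} 0&-1\\1&0\end{pmatrix}$.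
   Context: A quandle is a set $X$ with a binary operation $\triangleright$ such that (1) $x\triangleright x=x$ for all $x$; (2) for every $x\in X$ the right translation $R_x:X\to X$, $R_x(y)=y\triangleright x$, is a bijection; (3) $(x\triangleright y)\triangleright z=(x\triangleright z)\triangleright(y\triangleright z)$ for all $x,y,z$. $\operatorname{Inn}(X)=\langle R_x:x\in X\rangle\le\operatorname{Sym}(X)$. The quandle $X$ is primitive if the natural action of $\operatorname{Inn}(X)$ on $X$ is a primitive group action. For a group $G$ and a subset $C\subseteq G$ closed under conjugation, $\operatorname{Conj}(G,C)$ is the quandle on $C$ with operation $x\triangleright y=yxy^{-1}$. $\mathrm{PSL}(2,q)=\mathrm{SL}(2,q)/\{\pm I\}$. *)

(* Defs.v *)
From HB Require Import structures.
From mathcomp Require Import all_boot all_order all_algebra all_fingroup.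
From Corelib Require RelationClasses.

Set Implicit Arguments.
Unset Strict Implicit.
Unset Printing Implicit Defensive.

Import GRing.Theory.

Local Open Scope ring_scope.

Declare Scope quandle_scope.
Delimit Scope quandle_scope with QD.

Record quandle := Quandle {
  qsort :> Type;
  qop : qsort -> qsort -> qsort;
  qopxx : forall x, qop x x = x;
  qop_bij : forall x, bijective (fun y => qop y x);
  qopD : forall x y z, qop (qop x y) z = qop (qop x z) (qop y z)
}.

Notation "x |> y" := (qop x y) (at level 40, left associativity) : quandle_scope.
Local Open Scope quandle_scope.

Definition rtrans (X : quandle) (x y : X) : X := y |> x.

Definition quandle_iso (X Y : quandle) : Prop :=
  exists f : X -> Y, bijective f /\ forall x y, f (x |> y) = f x |> f y.

Definition has_card (X : Type) (n : nat) : Prop :=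
  exists f : X -> 'I_n, bijective f.

(* The carrier of a quandle is an arbitrary type, so a subgroup of Sym(X) is a *)
(* predicate on self-maps of X; the product of Sym(X) is composition.          *)
Inductive Inn (X : quandle) : (X -> X) -> Prop :=
| Inn_rtrans x : Inn (@rtrans X x)
| Inn_id : Inn id
| Inn_comp f g : Inn f -> Inn g -> Inn (f \o g)
| Inn_inv f g : Inn f -> cancel f g -> cancel g f -> Inn g.

Definition transitive_on (X : Type) (G : (X -> X) -> Prop) : Prop :=
  forall x y, exists2 g, G g & g x = y.

(* Invariant partitions are given by their equivalence relations.             *)
Definition primitive_on (X : Type) (G : (X -> X) -> Prop) : Prop :=
  transitive_on G /\
  forall E : X -> X -> Prop, RelationClasses.Equivalence E ->
    (forall g x y, G g -> E x y -> E (g x) (g y)) ->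
    (forall x y, E x y -> x = y) \/ (forall x y, E x y).

Definition primitive_quandle (X : quandle) : Prop := primitive_on (@Inn X).

(* G is isomorphic to H, with self-maps of X compared extensionally.          *)
Definition perm_isog (X : Type) (G : (X -> X) -> Prop)
    (gT : finGroupType) (H : {group gT}) : Prop :=
  exists phi : gT -> X -> X,
    [/\ {in H &, forall a b, phi (a * b)%g =1 phi a \o phi b},
        {in H &, forall a b, phi a =1 phi b -> a = b}
      & forall f, G f <-> exists2 a, a \in H & phi a =1 f].

Section Conj.

Variables (gT : finGroupType) (G : {group gT}) (C : {set gT}).

Definition conj_closed : Prop :=
  C \subset G /\ G \subset 'N(C)%g.

Hypothesis clC : conj_closed.

Let Cmem (x y : {x : gT | x \in C}) : (val y * val x * (val y)^-1)%g \in C.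
Proof.
case: clC => /subsetP sCG /subsetP nCG.
have -> : (val y * val x * (val y)^-1 = val x ^ (val y)^-1)%g.
  by rewrite conjgE invgK mulgA.
by rewrite memJ_norm ?(valP x) // groupV nCG // sCG // (valP y).
Qed.

Definition conj_op (x y : {x : gT | x \in C}) : {x : gT | x \in C} :=
  exist _ (val y * val x * (val y)^-1)%g (Cmem x y).

Let conj_opE x y : val (conj_op x y) = (val x ^ (val y)^-1)%g.
Proof. by rewrite /conj_op /= conjgE invgK mulgA. Qed.

Fact conj_opxx x : conj_op x x = x.
Proof. by apply: val_inj; rewrite /= mulgK. Qed.

Fact conj_op_bij x : bijective (fun y => conj_op y x).
Proof.
apply: injF_bij => y z /(congr1 val); rewrite !conj_opE => /conjg_inj.
exact: val_inj.
Qed.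

Fact conj_opD x y z :
  conj_op (conj_op x y) z = conj_op (conj_op x z) (conj_op y z).
Proof. by apply: val_inj; rewrite !conj_opE -conjVg -!conjgM conjgC. Qed.

Definition Conj : quandle := Quandle conj_opxx conj_op_bij conj_opD.

End Conj.

Arguments Conj {gT} G C clC.

Lemma class_conj_closed (gT : finGroupType) (G : {group gT}) (x : gT) :
  x \in G -> conj_closed G (x ^: G)%g.
Proof. by move=> Gx; split; [rewrite class_subG | exact: class_norm]. Qed.

Section PSL2.

Variable F : finFieldType.

Definition SL2 : {set {'GL_2[F]}} := [set g | \det (GLval g) == 1].

Fact SL2_group_set : group_set SL2.
Proof.
apply/group_setP; split=> [|g h]; first by rewrite inE det1.
rewrite !inE => /eqP dg /eqP dh.
by rewrite GL_ME detM dg dh mulr1.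
Qed.
Canonical SL2_group := Group SL2_group_set.

Definition pm1 : {set {'GL_2[F]}} :=
  [set g | (GLval g == 1) || (GLval g == -1)].

Fact pm1_group_set : group_set pm1.
Proof.
apply/group_setP; split=> [|g h]; first by rewrite inE eqxx.
rewrite !inE GL_ME => /orP[] /eqP-> /orP[] /eqP->;
  by rewrite ?mulrNN ?mulr1 ?mul1r eqxx ?orbT.
Qed.
Canonical pm1_group := Group pm1_group_set.

Definition PSL2 : {group coset_of pm1} := (SL2 / pm1)%G.

Definition mx2 (a b c d : F) : 'M[F]_2 :=
  \matrix_(i, j) if i == 0 then (if j == 0 then a else b)
                 else (if j == 0 then c else d).

Lemma det_mx2 a b c d : \det (mx2 a b c d) = a * d - b * c.
Proof.
rewrite (expand_det_row _ 0) !big_ord_recl big_ord0 !mxE /=.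
rewrite /cofactor !det_mx11 !mxE /= expr0 mul1r expr1 addr0.
by rewrite mulN1r mulrN.
Qed.

Fact det1_unit (M : 'M[F]_2) : \det M = 1 -> M \is a GRing.unit.
Proof. by move=> dM; rewrite -[_ \is a _]/(M \in unitmx) unitmxE dM unitr1. Qed.

Definition PSL2_of (M : 'M[F]_2) (detM : \det M = 1) : coset_of pm1 :=
  coset pm1 (FinRing.Unit (det1_unit detM) : {'GL_2[F]}).

Lemma PSL2_of_in M detM : @PSL2_of M detM \in PSL2.
Proof.
have SLM : (FinRing.Unit (det1_unit detM) : {'GL_2[F]}) \in SL2.
  by rewrite inE; apply/eqP.
apply: mem_quotient SLM.
Qed.

Fact det_split (i : F) : i ^+ 2 = -1 -> \det (mx2 i 0 0 (- i)) = 1.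
Proof. by move=> i2; rewrite det_mx2 mul0r subr0 mulrN -expr2 i2 opprK. Qed.

Fact det_nonsplit : \det (mx2 0 (-1) 1 0) = 1.
Proof. by rewrite det_mx2 mul0r mulr1 opprK add0r. Qed.

(* The class C_5 when q = 1 mod 4 ...                                         *)
Definition C5_split (i : F) (i2 : i ^+ 2 = -1) : {set coset_of pm1} :=
  (PSL2_of (det_split i2) ^: PSL2)%g.

(* ... and when q = 3 mod 4.                                                  *)
Definition C5_nonsplit : {set coset_of pm1} :=
  (PSL2_of det_nonsplit ^: PSL2)%g.

Lemma C5_split_closed (i : F) (i2 : i ^+ 2 = -1) :
  conj_closed PSL2 (C5_split i2).
Proof. exact/class_conj_closed/PSL2_of_in. Qed.

Lemma C5_nonsplit_closed : conj_closed PSL2 C5_nonsplit.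
Proof. exact/class_conj_closed/PSL2_of_in. Qed.

End PSL2.

(* Main.v *)
Require Import Defs.
From mathcomp Require Import all_boot all_order all_algebra all_fingroup.
From mathcomp Require Import all_solvable ring boolp.

(** Let X be a primitive quandle whose inner group is a nonabelian finite group
    G.  Two G-invariant equivalences on X decide everything.

    The relation R_x = R_y is one of them.  It is not total, since otherwise G
    would be cyclic; hence it is equality, and x |-> R_x identifies X with a
    conjugacy class of G.  If moreover the centraliser of one, hence of every,
    R_x is abelian, then R_x R_y = R_y R_x is also an invariant equivalence.
    It is not total, because the R_x generate G, so it is equality too: R_x is
    the only element of its class that commutes with R_x
    ([primitive_quandle_class]).

    In PSL(2,q) this leaves only the involutions.  Lift an element k with
    k^2 <> 1 to a matrix A of determinant 1.  It is not scalar and its trace is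
    not 0, so whatever commutes with k lifts to a matrix commuting with A
    itself, hence to a polynomial in A, and the centraliser of k is abelian
    ([PSL2_abelian_cent1]).  But k commutes with another of its conjugates: with
    its inverse when A is semisimple, and with 1 + s^2 N when A is up to sign a
    unipotent 1 + N ([second_conj_commuting]).  So R_x is an involution, that is,
    it lifts to a matrix of trace 0.

    All matrices of trace 0 and determinant 1 are conjugate in SL(2,q)
    ([trace0_conj]), so the involutions form a single class, represented by the
    matrix with rows (0 -1) and (1 0), and also by diag(i, -i) when i^2 = -1.
    The same description counts them: they are the solutions of a^2 + bc = -1
    up to sign, and there are q(q-1) + q s such solutions, where s is the number
    of square roots of -1 ([card_trace0_triples]).  Finally s is 2 or 0
    according to q modulo 4 ([neg1_square_mod4]). *)

Set Implicit Arguments.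
Unset Strict Implicit.
Unset Printing Implicit Defensive.

Import GRing.Theory.

(** * Primitive quandles as conjugacy classes *)

Section InnerGroup.

Variable X : quandle.
Local Open Scope quandle_scope.

Lemma Inn_morph (f : X -> X) : Inn f -> {morph f : x y / x |> y}.
Proof.
elim=> [z x y||g h _ mg _ mh x y|g h _ mg gK hK x y] //=.
- exact: qopD.
- by rewrite mh mg.
- by apply: (can_inj gK); rewrite mg !hK.
Qed.

Lemma Inn_rtransJ (f : X -> X) x :
  Inn f -> rtrans (f x) \o f =1 f \o rtrans x.
Proof. by move=> If y; rewrite /= /rtrans (Inn_morph If). Qed.

(** The commutation of generators passes to the group in two rounds of the same
    induction, one for each argument. *)
Lemma Inn_comm :
  (forall x y : X, rtrans x \o rtrans y =1 rtrans y \o rtrans x) ->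
  forall f g : X -> X, Inn f -> Inn g -> f \o g =1 g \o f.
Proof.
move=> Rcomm f g If.
have commR (h : X -> X) :
    (forall x, h \o rtrans x =1 rtrans x \o h) ->
    forall k, Inn k -> h \o k =1 k \o h.
  move=> hR k; elim=> [x||k1 k2 _ IH1 _ IH2 y|k1 k2 _ IH k1K k2K y] //=.
    by have /= -> := IH1 (k2 y); have /= -> := IH2 y.
  by apply: (can_inj k1K); have /= <- := IH (k2 y); rewrite !k2K.
by apply: (commR) => x y; rewrite (commR _ (Rcomm x) f If y).
Qed.

End InnerGroup.

Section PrimitiveQuandle.

Variables (X : quandle) (gT : finGroupType) (G : {group gT}).
Hypothesis primX : primitive_quandle X.
Hypothesis innX : perm_isog (@Inn X) G.
Hypothesis nabG : ~~ abelian G.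

Local Open Scope group_scope.

(** The abelian centraliser makes commutation transitive on the class, since two
    elements commuting with a third one lie in its centraliser. *)
Theorem primitive_quandle_class :
  exists a (Ga : a \in G),
    [/\ quandle_iso X (Conj G (a ^: G) (class_conj_closed Ga)), a != 1
      & abelian 'C_G[a] -> 'C_G[a] :&: a ^: G = [set a] ].
Proof.
case: innX => phi [phiM phi_inj phi_Inn].
have Iphi a : a \in G -> Inn (phi a) by move=> Ga; apply/phi_Inn; exists a.
have [r rP] : {r : X -> gT & forall x, r x \in G /\ phi (r x) =1 rtrans x}.
  apply: (@choice X gT (fun x a => a \in G /\ phi a =1 rtrans x)) => x.
  by have /phi_Inn[a] := Inn_rtrans x; exists a.
have Gr x : r x \in G by case: (rP x).
have phir x : phi (r x) =1 rtrans x by case: (rP x).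
have phiMr a b y : a \in G -> b \in G -> phi (a * b) y = phi a (phi b y).
  by move=> Ga Gb; rewrite phiM.
have rJ a x : a \in G -> r (phi a x) = r x ^ a^-1.
  move=> Ga; apply: (mulIg a); rewrite conjgE invgK mulgA mulgKV.
  apply: phi_inj; rewrite ?groupM // => y.
  rewrite !phiMr // !phir.
  exact: (Inn_rtransJ x (Iphi _ Ga) y).
have r_op x y : r (qop x y) = r y * r x * (r y)^-1.
  by rewrite -[qop x y](phir y) rJ // conjgE invgK mulgA.
(* The r x generate G, so they do not all commute. *)
have Ncomm : ~ (forall x y, commute (r x) (r y)).
  move=> rC; move/negP: nabG; apply; apply/centsP => a Ga b Gb.
  apply: phi_inj; rewrite ?groupM // => z; rewrite !phiMr //.
  apply: Inn_comm (Iphi _ Ga) (Iphi _ Gb) _ => x y t /=.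
  by rewrite -!phir -!phiMr // rC.
case: primX => transX blockX.
have [x0] : exists x0 : X, True.
  apply: contrapT => noX; apply: Ncomm => x; case: noX; by exists x.
move=> _.
have r_inj x y : r x = r y -> x = y.
  case: (blockX (fun u v => r u = r v)) => [|g u v /phi_Inn[a Ga ag] ruv|rI|rE].
  - by split=> [u|u v ->|u v w -> ->].
  - by rewrite -!ag !rJ // ruv.
  - exact: rI.
  by case: Ncomm => u v; rewrite (rE u v).
have class_r x : r x \in r x0 ^: G.
  have [g /phi_Inn[a Ga ag] <-] := transX x0 x.
  by rewrite -ag rJ // memJ_class ?groupV.
exists (r x0), (Gr x0); split.
- exists (fun x => exist _ (r x) (class_r x)); split.
    have [s sK] : {s : {b | b \in r x0 ^: G} -> X &
        forall b, exist _ (r (s b)) (class_r (s b)) = b}.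
      apply: (@choice _ X
          (fun b x => exist _ (r x) (class_r x) = b :> {b | b \in r x0 ^: G})).
      move=> [b rGb]; have /imsetP[a Ga bE] := rGb.
      by exists (phi a^-1 x0); apply: val_inj; rewrite /= rJ ?groupV // invgK.
    by exists s => // x; apply: r_inj; apply: (congr1 val (sK _)).
  by move=> x y; apply: val_inj; rewrite /= r_op.
- apply/eqP => rx0; case: Ncomm => x y.
  have r1 z : r z = 1.
    by have:= class_r z; rewrite rx0 class1G => /set1P.
  by rewrite !r1.
move=> abC; apply/eqP; rewrite eqEsubset sub1set 2!in_setI.
rewrite cent1id Gr class_refl !andbT.
have abCr x : abelian 'C_G[r x].
  have /imsetP[a Ga ->] := class_r x.
  by rewrite -[X in 'C_X[_]](conjGid Ga) cent1J -conjIg abelianJ.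
have commT x y z : commute (r x) (r y) -> commute (r y) (r z) ->
    commute (r x) (r z).
  move=> cxy cyz; apply: (centsP (abCr y)); rewrite inE Gr; exact/cent1P.
apply/subsetP => b /setIP[/setIP[Gb /cent1P cb]] /imsetP[a Ga bE].
have bE' : b = r (phi a^-1 x0) by rewrite rJ ?groupV // invgK.
rewrite {}bE' in Gb cb *; apply/set1P; congr (r _); apply/esym.
case: (blockX (fun u v => commute (r u) (r v)))
  => [|g u v /phi_Inn[c Gc cg] cuv|EI|//].
- split=> [u|u v|u v w]; [exact: commute_refl | exact: commute_sym |].
  exact: commT.
- by rewrite -!cg !rJ // /commute -!conjMg cuv.
exact: EI.
Qed.

End PrimitiveQuandle.

(** * Squares in a finite field of odd order *)

Local Open Scope ring_scope.

Section OddField.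

Variable F : finFieldType.
Hypothesis oddF : odd #|F|.

(** Translation by 1 permutes F, so the sum of all elements shows that the order
    of F vanishes in F; an odd number cannot do so when 2 = 0. *)
Lemma odd_card_two_neq0 : (2 : F) != 0.
Proof.
apply/eqP => F2.
have /eqP : \sum_(x : F) x = \sum_(x : F) (x + 1).
  by rewrite (reindex_inj (addIr (1 : F))).
rewrite big_split /= sumr_const -subr_eq0 opprD addrA subrr add0r oppr_eq0.
rewrite -(odd_double_half #|F|) oddF -muln2 mulrnDr mulrnA mulr1n.
by rewrite -[_ *+ 2]mulr_natr F2 mulr0 addr0 oner_eq0.
Qed.

(** For a function with the fibers of squaring.  The inequality is strict because
    the order of F is odd. *)
Lemma card_image_fiber2 (f : F -> F) :
  (forall x y, f x = f y -> y = x \/ y = - x) ->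
  (#|F| < 2 * #|[set f x | x in F]|)%N.
Proof.
move=> f2.
have : (#|F| <= 2 * #|[set f x | x in F]|)%N.
  rewrite -[leqLHS]sum1_card (partition_big_imset f) /= mulnC -sum_nat_const.
  apply: leq_sum => y /imsetP[x _ ->]; rewrite sum1dep_card.
  have /subset_leq_card : [set i | f i == f x] \subset [set x; - x].
    apply/subsetP => z; rewrite !inE => /eqP/esym/f2[] ->; rewrite eqxx ?orbT //.
  by move=> /leq_trans; apply; rewrite cards2; case: (_ != _).
rewrite leq_eqVlt => /orP[/eqP E|//].
by move: oddF; rewrite E oddM.
Qed.

(** Pigeonhole: the values of u^2 and those of e + D v^2 each fill more than half
    of F, so they have a common value. *)
Lemma binary_form_universal (D e : F) : D != 0 ->
  exists u v : F, u ^+ 2 - D * v ^+ 2 = e.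
Proof.
move=> D0; set S := [set u ^+ 2 | u in F]; set T := [set e + D * v ^+ 2 | v in F].
have sq_eq (x y : F) : x ^+ 2 = y ^+ 2 -> y = x \/ y = - x.
  by move=> /eqP; rewrite eq_sym eqf_sqr => /orP[]/eqP; [left | right].
have S2 : (#|F| < 2 * #|S|)%N by apply: card_image_fiber2.
have T2 : (#|F| < 2 * #|T|)%N.
  by apply: card_image_fiber2 => x y /addrI/(mulfI D0); apply: sq_eq.
have [x] : exists x, x \in S :&: T.
  apply/set0Pn; apply: contraTneq (max_card (mem (S :|: T))) => ST0.
  rewrite -ltnNge cardsU ST0 cards0 subn0 -(ltn_pmul2l (isT : 0 < 2)%N) mulnDr.
  by rewrite mul2n -addnn; apply: ltnW; rewrite -addSn -addnS leq_add.
rewrite inE => /andP[/imsetP[u _ ->] /imsetP[v _ uv]].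
by exists u, v; rewrite uv addrK.
Qed.

(** A square root of -1 is an element of order 4 in the cyclic group of units,
    which has order #|F| - 1. *)
Lemma neg1_square_mod4 : (exists i : F, i ^+ 2 = -1) <-> #|F| = 1 %[mod 4].
Proof.
have F2 := odd_card_two_neq0.
have N1 : (-1 : F) != 1.
  by rewrite -subr_eq0 -opprD oppr_eq0.
have F0 : (0 < #|F|)%N by apply/card_gt0P; exists 0.
have -> : (#|F| = 1 %[mod 4]) <-> (4 %| #|F|.-1)%N.
  by rewrite -subn1 -eqn_mod_dvd //; split=> [->|/eqP ->].
rewrite -card_finField_unit; split.
- case=> i i2.
  have Ui : i \is a GRing.unit.
    by rewrite unitfE; apply: contra_eqN i2 => /eqP ->;
      rewrite expr0n eq_sym oppr_eq0 oner_eq0.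
  pose u : {unit F} := FinRing.Unit Ui.
  have uv k : (u ^+ k)%g = 1%g <-> i ^+ k = 1.
    rewrite -[i]/(val u); split=> [/(congr1 val)|uk].
      by rewrite FinRing.val_unitX.
    by apply: val_inj; rewrite FinRing.val_unitX.
  have ou : (#[u]%g %| 2 ^ 2)%N.
    by rewrite order_dvdn; apply/eqP/uv; rewrite exprM i2 expr2 mulrNN mulr1.
  have nu2 : ~~ (#[u]%g %| 2)%N.
    by rewrite order_dvdn; apply/eqP => /uv; rewrite i2 => /eqP; rewrite (negbTE N1).
  have [k k2 uE] := dvdn_pfactor _ _ (isT : prime 2) ou.
  have -> : 4%N = #[u]%g by case: k k2 uE => [|[|[|k]]] // _ uE; rewrite uE in nu2.
  by apply: order_dvdG; rewrite inE.
- have /cyclicP[u uE] := field_unit_group_cyclic [set: {unit F}].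
  rewrite uE -/#[u]%g => /dvdnP[m ou]; exists (val (u ^+ m)%g).
  have u2 : val (u ^+ m)%g ^+ 2 = val (u ^+ (m * 2))%g.
    by rewrite expgM !FinRing.val_unitX.
  have : val (u ^+ m)%g ^+ 2 ^+ 2 == 1.
    by rewrite u2 -FinRing.val_unitX -expgM -mulnA -ou expg_order.
  rewrite sqrf_eq1 => /orP[/eqP|/eqP//]; rewrite u2 -(@FinRing.val_unit1 F).
  move=> /val_inj/eqP; rewrite -order_dvdn ou dvdn_pmul2l //.
  by move: (order_gt0 u); rewrite ou muln_gt0 => /andP[].
Qed.

End OddField.

(** * Conjugacy and commutation of 2 x 2 matrices *)

Section Matrices.

Variable F : finFieldType.
Implicit Types (a b c d x y z w s t : F) (M N P A B C : 'M[F]_2).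

Lemma mx2_eta M : M = mx2 (M 0 0) (M 0 1) (M 1 0) (M 1 1).
Proof.
by apply/matrixP => -[[|[|//]] i] [[|[|//]] j]; rewrite mxE;
  congr (M _ _); apply: val_inj.
Qed.

Lemma mx2_inj a b c d x y z w :
  mx2 a b c d = mx2 x y z w -> [/\ a = x, b = y, c = z & d = w].
Proof.
move=> E; split.
- by have:= congr1 (fun M => M 0 0) E; rewrite !mxE.
- by have:= congr1 (fun M => M 0 1) E; rewrite !mxE.
- by have:= congr1 (fun M => M 1 0) E; rewrite !mxE.
- by have:= congr1 (fun M => M 1 1) E; rewrite !mxE.
Qed.

Lemma mulmx2 a b c d x y z w :
  mx2 a b c d * mx2 x y z w =
  mx2 (a * x + b * z) (a * y + b * w) (c * x + d * z) (c * y + d * w).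
Proof.
by rewrite [LHS]mx2_eta; congr mx2; rewrite mxE big_ord_recl big_ord1 !mxE.
Qed.

Lemma oppmx2 a b c d : - mx2 a b c d = mx2 (- a) (- b) (- c) (- d).
Proof. by rewrite [LHS]mx2_eta; congr mx2; rewrite !mxE. Qed.

Lemma scalar_mx2 a : a%:M = mx2 a 0 0 a.
Proof. by rewrite [LHS]mx2_eta; congr mx2; rewrite !mxE ?mulr1n ?mulr0n. Qed.

Lemma trace_mx2 a b c d : \tr (mx2 a b c d) = a + d.
Proof. by rewrite /mxtrace big_ord_recl big_ord1 !mxE. Qed.

(** The vectors (A00 - A11, A01, A10) and (B00 - B11, B01, B10) are parallel when
    A and B commute; the first is not 0, and the ratio is read off at any of its
    nonzero entries. *)
Lemma commute_nonscalar A B : ~~ is_scalar_mx A -> A * B = B * A ->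
  exists s t, B = s%:M + t *: A.
Proof.
rewrite [A]mx2_eta [B]mx2_eta.
move: (A 0 0) (A 0 1) (A 1 0) (A 1 1) => a b c d.
move: (B 0 0) (B 0 1) (B 1 0) (B 1 1) => x y z w nsA.
rewrite !mulmx2 => /mx2_inj[e1 e2 e3 e4].
have sumE s t : x = s + t * a -> y = t * b -> z = t * c -> w = s + t * d ->
    exists s t, mx2 x y z w = s%:M + t *: mx2 a b c d.
  move=> -> -> -> ->; exists s, t; rewrite [RHS]mx2_eta.
  by congr mx2; rewrite !mxE ?mulr1n ?mulr0n ?add0r.
have [b0|b0] := eqVneq b 0; last first.
  apply: (sumE (x - y / b * a) (y / b)); first by ring.
  - by field.
  - apply: (mulfI b0); have -> : b * (y / b * c) = y * c by field.
    by apply: (addrI (a * x)); rewrite e1; ring.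
  - apply: (mulfI b0).
    have -> : b * (x - y / b * a + y / b * d) = (x * b + y * d) - a * y by field.
    by rewrite -e2; ring.
have [c0|c0] := eqVneq c 0; last first.
  apply: (sumE (x - z / c * a) (z / c)); first by ring.
  - apply: (mulfI c0); have -> : c * (z / c * b) = b * z by field.
    by apply: (addrI (a * x)); rewrite e1; ring.
  - by field.
  - apply: (mulfI c0).
    have -> : c * (x - z / c * a + z / c * d) = (c * x + d * z) - a * z by field.
    by rewrite e3; ring.
have ad : a - d != 0.
  apply: contraNneq nsA => ad; rewrite b0 c0 (subr0_eq ad) -scalar_mx2.
  exact: scalar_mx_is_scalar.
rewrite {}b0 {}c0 in sumE e2 e3 *.
apply: (sumE (x - (x - w) / (a - d) * a) ((x - w) / (a - d))); first by ring.
- rewrite mulr0; apply: (mulfI ad); rewrite mulr0.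
  have -> : (a - d) * y = (a * y + 0 * w) - y * d by ring.
  by rewrite e2; ring.
- rewrite mulr0; apply: (mulfI ad); rewrite mulr0.
  have -> : (a - d) * z = (z * a + w * 0) - d * z by ring.
  by rewrite -e3; ring.
- by field.
Qed.

Lemma commute_centralizer A B C : ~~ is_scalar_mx A ->
  A * B = B * A -> A * C = C * A -> B * C = C * B.
Proof.
move=> nsA /(commute_nonscalar nsA)[s [t ->]] /(commute_nonscalar nsA)[x [y ->]].
rewrite !(mulmxDl, mulmxDr, =^~ mulmxE) !mul_scalar_mx !mul_mx_scalar.
rewrite -!scalemxAl -!scalemxAr !scalerA scale_scalar_mx -!addrA.
rewrite scale_scalar_mx [t * y]mulrC [s * x]mulrC; congr (_ + _); exact: addrCA.
Qed.

Lemma det1_mul A B : \det A = 1 -> \det B = 1 -> \det (A * B) = 1.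
Proof. by move=> dA dB; rewrite det_mulmx dA dB mulr1. Qed.

Lemma trace_conj A B P : \det P = 1 -> P * A = B * P -> \tr A = \tr B.
Proof.
move=> /det1_unit Pu E.
have -> : B = P * A * P^-1 by rewrite E mulrK.
by rewrite -mulmxE mxtrace_mulC mulmxE mulKr.
Qed.

End Matrices.

Section OddMatrices.

Variable F : finFieldType.
Hypothesis oddF : odd #|F|.
Implicit Types (a b c d x y z w s t : F) (M N P A B C : 'M[F]_2).

Let F2 : (2 : F) != 0. Proof. exact: odd_card_two_neq0. Qed.

Let F4 : (4 : F) != 0.
Proof. by rewrite (_ : 4 = 2 * 2) ?mulf_neq0 //; ring. Qed.

Lemma oppr_eq_self x : x = - x -> x = 0.
Proof.
move=> xN; apply: (mulfI F2); rewrite mulr0 mulr_natl mulr2n.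
by rewrite {2}xN subrr.
Qed.

(** Here A is conjugate to -A. *)
Lemma anticommute_trace0 A B : \det B = 1 -> A * B = - (B * A) -> \tr A = 0.
Proof.
move=> dB E; apply: oppr_eq_self.
rewrite -raddfN /=; apply/esym/(trace_conj dB).
by rewrite mulrN E.
Qed.

Lemma mx2_cayley M : M * M = (\tr M) *: M - (\det M)%:M.
Proof.
rewrite [M]mx2_eta trace_mx2 det_mx2 mulmx2 scalar_mx2 [RHS]mx2_eta.
by congr mx2; rewrite !mxE /=; ring.
Qed.

(** The matrix tr A - A is the inverse of A.  The P intertwining it with A are
    those of trace 0 with tr (P A) = 0: a plane, on which the determinant is a
    binary form with discriminant D = (tr A)^2 - 4 up to squares, nondegenerate
    as D is not 0; so it takes the value 1. *)
Lemma conj_adjugate A : \det A = 1 -> ~~ is_scalar_mx A ->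
    \tr A ^+ 2 != 4 ->
  exists2 P, \det P = 1 & P * A = ((\tr A)%:M - A) * P.
Proof.
rewrite [A]mx2_eta.
move: (A 0 0) (A 0 1) (A 1 0) (A 1 1) => a b c d.
rewrite det_mx2 trace_mx2 => dA nsA t4.
have -> : (a + d)%:M - mx2 a b c d = mx2 d (- b) (- c) a.
  by rewrite scalar_mx2 [LHS]mx2_eta; congr mx2; rewrite !mxE /=; ring.
pose D := (a + d) ^+ 2 - 4.
have D0 : D != 0 by rewrite subr_eq0.
have DE : D = (a - d) ^+ 2 + 4 * (b * c).
  have -> : b * c = a * d - 1 by rewrite -dA; ring.
  by rewrite /D; ring.
suff [x [y [z [lin quad]]]] : exists x y z,
    x * (a - d) + y * c + z * b = 0 /\ x ^+ 2 + y * z = -1.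
  exists (mx2 x y z (- x)).
    by rewrite det_mx2; apply: oppr_inj; rewrite -quad; ring.
  rewrite !mulmx2; congr mx2; apply/eqP; rewrite -subr_eq0; apply/eqP.
  - by rewrite -lin; ring.
  - by ring.
  - by ring.
  - by rewrite -lin; ring.
have [u [v uv]] := binary_form_universal oddF (-1) D0.
have [c0|c0] := eqVneq c 0; last first.
  pose x := u + (a - d) * v; pose z := 2 * c * v.
  exists x, (- (x * (a - d) + z * b) / c), z; split; first by field.
  by rewrite -uv DE /x /z; field.
have [b0|b0] := eqVneq b 0; last first.
  pose x := u + (a - d) * v; pose y := 2 * b * v.
  exists x, y, (- (x * (a - d) + y * c) / b); split; first by field.
  by rewrite -uv DE /x /y; field.
by exists 0, 1, (-1); rewrite b0 c0; split; ring.
Qed.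

(** With e = tr A / 2 and N = A - e nilpotent, the matrix on the right is
    e + s^2 N.  Letting P act as s on a vector v spanning the image of N, and as
    1/s modulo v, gives P N = s^2 N P. *)
Lemma unipotent_conj A s : \det A = 1 -> ~~ is_scalar_mx A ->
    \tr A ^+ 2 = 4 -> s != 0 ->
  exists2 P, \det P = 1
    & P * A = (((1 - s ^+ 2) * (\tr A / 2))%:M + s ^+ 2 *: A) * P.
Proof.
rewrite [A]mx2_eta.
move: (A 0 0) (A 0 1) (A 1 0) (A 1 1) => a b c d.
rewrite det_mx2 trace_mx2 => dA nsA t4 s0.
pose e := (a + d) / 2; pose n := (a - d) / 2.
(* N has rows (n b) and (c -n). *)
have nil : n ^+ 2 + b * c = 0.
  have -> : n ^+ 2 + b * c = ((a + d) ^+ 2 - 4 * (a * d - b * c)) / 4.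
    by rewrite /n; field; rewrite F4 F2.
  by rewrite t4 dA mulr1 subrr mul0r.
have -> : mx2 a b c d = mx2 (e + n) b c (e - n).
  by congr mx2; rewrite /e /n; field.
have -> : ((1 - s ^+ 2) * ((a + d) / 2))%:M + s ^+ 2 *: mx2 (e + n) b c (e - n)
   = mx2 (e + s ^+ 2 * n) (s ^+ 2 * b) (s ^+ 2 * c) (e - s ^+ 2 * n).
  rewrite scalar_mx2 -/e [LHS]mx2_eta; congr mx2; rewrite !mxE /=; ring.
have [c0|c0] := eqVneq c 0.
  have n0 : n = 0 by apply/eqP; rewrite -sqrf_eq0 -nil c0 mulr0 addr0.
  exists (mx2 s 0 0 s^-1); first by rewrite det_mx2; field.
  by rewrite !mulmx2 c0 n0; congr mx2; field.
have bE : b = - n ^+ 2 / c.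
  by apply: (mulIf c0); rewrite divfK //; apply/eqP; rewrite -addr_eq0 addrC nil.
(* Here (n, c) spans the image of N, and P sends (1, 0) to (1/s, 0). *)
exists (mx2 s^-1 (n * (s - s^-1) / c) 0 s); first by rewrite det_mx2; field; rewrite c0.
by rewrite bE !mulmx2; congr mx2; field; rewrite ?c0.
Qed.

Lemma exists_sq_neq1 : (3 < #|F|)%N -> exists2 s : F, s != 0 & s ^+ 2 != 1.
Proof.
move=> q_gt3; have [s] : exists s, s \notin [:: 0 : F; 1; -1].
  apply/existsP; apply: contraTT q_gt3; rewrite negb_exists -leqNgt => /forallP sub.
  apply: leq_trans (card_size [:: 0 : F; 1; -1]); apply/subset_leq_card/subsetP => s _.
  by have := sub s; rewrite negbK.
rewrite !inE !negb_or => /and3P[s0 s1 sN1].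
by exists s => //; rewrite sqrf_eq1 negb_or s1.
Qed.

(** The second conjugate is a polynomial x + y A with y <> 1, from the previous
    lemmas according to whether A has distinct eigenvalues; in the unipotent case
    y is a square s^2 other than 0 and 1, hence the bound on #|F|. *)
Lemma second_conj_commuting A : (3 < #|F|)%N ->
    \det A = 1 -> ~~ is_scalar_mx A ->
  exists P B, [/\ \det P = 1, P * A = B * P, A * B = B * A & B != A].
Proof.
move=> q_gt3 dA nsA.
have polyA x y : y != 1 -> A * (x%:M + y *: A) = (x%:M + y *: A) * A
    /\ x%:M + y *: A != A.
  move=> y1; split.
    rewrite !(mulmxDl, mulmxDr, =^~ mulmxE) -scalemxAr -scalemxAl.
    by rewrite -scalar_mxC.
  apply: contraNneq nsA => E; apply/is_scalar_mxP; exists (x / (1 - y)).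
  have xE : x%:M = (1 - y) *: A by rewrite scalerBl scale1r -{1}E addrK.
  rewrite mulrC -scale_scalar_mx xE scalerA mulVf ?scale1r //.
  by rewrite subr_eq0 eq_sym.
have [t4|t4] := eqVneq (\tr A ^+ 2) 4.
  have [s s0 s1] := exists_sq_neq1 q_gt3.
  have [P dP PA] := unipotent_conj dA nsA t4 s0.
  have [cB neB] := polyA ((1 - s ^+ 2) * (\tr A / 2)) _ s1.
  by exists P, (((1 - s ^+ 2) * (\tr A / 2))%:M + s ^+ 2 *: A).
have [P dP PA] := conj_adjugate dA nsA t4.
have /polyA-/(_ (\tr A)) : (-1 : F) != 1.
  by rewrite eq_sym; apply/eqP => /oppr_eq_self/eqP; rewrite oner_eq0.
by rewrite scaleN1r => -[cB neB]; exists P, ((\tr A)%:M - A).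
Qed.

(** Write J for the matrix on the right.  The first row of P A = J P says that the
    second row of P is - (x y) A, where (x y) is the first row of P; the other
    row of the equation then holds since A^2 = -1.  The determinant of P is a
    nondegenerate binary quadratic form in x and y, and so it takes the value 1. *)
Lemma trace0_conj A : \det A = 1 -> \tr A = 0 ->
  exists2 P, \det P = 1 & P * A = mx2 0 (-1) 1 0 * P.
Proof.
rewrite [A]mx2_eta.
move: (A 0 0) (A 0 1) (A 1 0) (A 1 1) => a b c d.
rewrite det_mx2 trace_mx2 => dA /eqP; rewrite addrC addr_eq0 => /eqP dE.
rewrite {d}dE in dA *.
suff [x [y xy]] : exists x y, - b * x ^+ 2 + 2 * a * x * y + c * y ^+ 2 = 1.
  exists (mx2 x y (- (x * a + y * c)) (y * a - x * b)).
    by rewrite det_mx2 -xy; ring.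
  rewrite !mulmx2; congr mx2; try by ring.
    by apply/eqP; rewrite -subr_eq0 -[X in _ == X](mulr0 x) -(subrr 1) -{1}dA;
      apply/eqP; ring.
  by apply/eqP; rewrite -subr_eq0 -[X in _ == X](mulr0 y) -(subrr 1) -{1}dA;
    apply/eqP; ring.
have [c0|c0] := eqVneq c 0.
  have a0 : a != 0.
    by apply: contra_eqN dA => /eqP ->; rewrite c0 mulr0 mul0r subr0 eq_sym oner_eq0.
  exists 1, ((1 + b) / (2 * a)); rewrite c0.
  by field; rewrite a0.
have N1 : (-1 : F) != 0 by rewrite oppr_eq0 oner_eq0.
have [u [x ux]] := binary_form_universal oddF c N1.
exists x, ((u - a * x) / c); apply: (mulfI c0).
have -> : c * 1 = u ^+ 2 + (a * - a - b * c) * x ^+ 2.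
  by rewrite dA mulr1 -[LHS]ux; ring.
by field.
Qed.

End OddMatrices.

(** * The involutions of PSL(2,q) *)

Section PSL2Elements.

Variable F : finFieldType.
Implicit Types (A B P : 'M[F]_2) (g h : {'GL_2[F]}).

Lemma pm1_norm g : g \in 'N(pm1 F)%g.
Proof.
apply: (subsetP (cents_norm _)) (in_setT g); apply/centsP => x _ y.
by rewrite inE => /orP[] /eqP y1; apply: val_inj;
  rewrite -[LHS]/(GLval _) -[RHS]/(GLval _) !GL_ME y1 ?mulr1 ?mul1r ?mulrN1 ?mulN1r.
Qed.

Lemma coset_PSL2_of g (dg : \det (GLval g) = 1) : coset (pm1 F) g = PSL2_of dg.
Proof. by congr (coset _ _); apply: val_inj. Qed.

Lemma PSL2P (k : coset_of (pm1 F)) :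
  k \in PSL2 F -> exists A (dA : \det A = 1), k = PSL2_of dA.
Proof.
case/morphimP => g _; rewrite inE => /eqP dg ->.
by exists (GLval g), dg; apply: coset_PSL2_of.
Qed.

Lemma coset_pm1P g h :
  coset (pm1 F) g = coset (pm1 F) h <-> GLval g = GLval h \/ GLval g = - GLval h.
Proof.
have -> : coset (pm1 F) g = coset (pm1 F) h <-> g \in (pm1 F :* h)%g.
  by split=> [|E]; [move/(rcoset_kercosetP (pm1_norm g) (pm1_norm h))
    | apply/(rcoset_kercosetP (pm1_norm g) (pm1_norm h))].
rewrite mem_rcoset inE GL_ME GL_VE; set Q := GLval h.
have Qu : Q \is a GRing.unit := GL_unit h.
by split=> [/orP[]/eqP E|[]E];
  [left | right | apply/orP; left | apply/orP; right];
  rewrite ?[GLval g](canRL (mulrVK Qu) E) ?mul1r ?mulN1r //; rewrite E ?mulNr divrr.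
Qed.

Lemma PSL2_of_eqP A B (dA : \det A = 1) (dB : \det B = 1) :
  PSL2_of dA = PSL2_of dB <-> A = B \/ A = - B.
Proof. exact: coset_pm1P. Qed.

Lemma PSL2_ofM A B (dA : \det A = 1) (dB : \det B = 1) :
  (PSL2_of dA * PSL2_of dB)%g = PSL2_of (det1_mul dA dB).
Proof.
rewrite /PSL2_of -coset_morphM ?pm1_norm //; congr (coset _ _).
exact: val_inj.
Qed.

Lemma PSL2_of_eq1 A (dA : \det A = 1) :
  PSL2_of dA = 1%g <-> A = 1 \/ A = - 1.
Proof.
have -> : 1%g = PSL2_of (det1 F 2).
  by rewrite -(morph1 (coset (pm1 F))); congr (coset _ _); exact: val_inj.
exact: PSL2_of_eqP.
Qed.

Lemma PSL2_of_commute A B (dA : \det A = 1) (dB : \det B = 1) :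
  commute (PSL2_of dA) (PSL2_of dB) <-> A * B = B * A \/ A * B = - (B * A).
Proof. by rewrite /commute !PSL2_ofM; apply: PSL2_of_eqP. Qed.

Lemma PSL2_of_class A B P (dA : \det A = 1) (dB : \det B = 1) :
  \det P = 1 -> P * A = B * P -> PSL2_of dB \in (PSL2_of dA ^: PSL2 F)%g.
Proof.
move=> dP PA; have E : (PSL2_of dP * PSL2_of dA = PSL2_of dB * PSL2_of dP)%g.
  by rewrite !PSL2_ofM; apply/PSL2_of_eqP; left.
have -> : PSL2_of dB = (PSL2_of dA ^ (PSL2_of dP)^-1)%g.
  by rewrite conjgE invgK mulgA E mulgK.
by rewrite memJ_class // groupV PSL2_of_in.
Qed.

Hypothesis oddF : odd #|F|.

Lemma PSL2_nonabelian : ~~ abelian (PSL2 F).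
Proof.
have dU : \det (mx2 1 1 0 1 : 'M[F]_2) = 1 by rewrite det_mx2; ring.
apply/negP => /centsP/(_ _ (PSL2_of_in dU) _ (PSL2_of_in (det_nonsplit F))).
move/PSL2_of_commute; rewrite !mulmx2 oppmx2 => -[] /mx2_inj[/eqP + _ _ _];
  by rewrite !(mul1r, mul0r, mulr0, add0r, addr0, oppr0) oner_eq0.
Qed.

Lemma PSL2_of_scalar A (dA : \det A = 1) :
  is_scalar_mx A -> PSL2_of dA = 1%g.
Proof.
case/is_scalar_mxP=> c AE; apply/PSL2_of_eq1; rewrite AE.
have /eqP := dA; rewrite AE det_scalar sqrf_eq1 => /orP[]/eqP ->; [left | right] => //.
by rewrite raddfN.
Qed.

(** By Cayley-Hamilton A^2 = (tr A) A - 1, which is not scalar when A is not and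
    its trace is not 0. *)
Lemma PSL2_sqr_eq1 A (dA : \det A = 1) :
  PSL2_of dA != 1%g -> (PSL2_of dA ^+ 2)%g = 1%g <-> \tr A = 0.
Proof.
move=> A1; rewrite expgS expg1 PSL2_ofM PSL2_of_eq1 mx2_cayley dA.
split=> [E|->]; last by rewrite scale0r sub0r; right.
have [//|t0] := eqVneq (\tr A) 0; case/eqP: A1; apply: PSL2_of_scalar.
have [c tA] : exists c, \tr A *: A = c%:M.
  case: E => /(canRL (subrK _)) ->; first by exists (1 + 1); rewrite raddfD.
  by exists 0; rewrite addNr raddf0.
apply/is_scalar_mxP; exists ((\tr A)^-1 * c).
by rewrite -scale_scalar_mx -tA scalerA mulVf ?scale1r.
Qed.

(** Matrices commuting only up to sign have trace 0, so for A of nonzero trace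
    commutation in PSL(2,q) is commutation of the lifts. *)
Lemma PSL2_abelian_cent1 k : k \in PSL2 F ->
  (k ^+ 2)%g != 1%g -> abelian 'C_(PSL2 F)[k].
Proof.
case/PSL2P => A [dA ->] A2.
have A1 : PSL2_of dA != 1%g by apply: contraNneq A2 => ->; rewrite expg1n.
have nsA : ~~ is_scalar_mx A by apply: contraNN A1 => /PSL2_of_scalar ->.
have tA : \tr A <> 0 by move/(PSL2_sqr_eq1 A1)/eqP; apply/negP.
have centA B (dB : \det B = 1) : PSL2_of dB \in 'C[PSL2_of dA]%g -> A * B = B * A.
  by move/cent1P/commute_sym/PSL2_of_commute => [//|/(anticommute_trace0 oddF dB)/tA].
apply/centsP => _ /setIP[/PSL2P[B [dB ->]] cB] _ /setIP[/PSL2P[C [dC ->]] cC].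
apply/PSL2_of_commute; left.
exact: (commute_centralizer nsA (centA _ _ cB) (centA _ _ cC)).
Qed.

Lemma PSL2_class_meets_cent1 k : (3 < #|F|)%N -> k \in PSL2 F ->
  (k ^+ 2)%g != 1%g -> ('C_(PSL2 F)[k] :&: k ^: PSL2 F)%g != [set k].
Proof.
move=> q_gt3 /PSL2P[A [dA ->]] A2.
have A1 : PSL2_of dA != 1%g by apply: contraNneq A2 => ->; rewrite expg1n.
have nsA : ~~ is_scalar_mx A by apply: contraNN A1 => /PSL2_of_scalar ->.
have tA : \tr A <> 0 by move/(PSL2_sqr_eq1 A1)/eqP; apply/negP.
have [P [B [dP PA cAB neBA]]] := second_conj_commuting oddF q_gt3 dA nsA.
have dB : \det B = 1.
  have := congr1 (determinant (n := 2)) PA.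
  by rewrite !det_mulmx dA dP !mulr1 => <-.
apply/eqP => /setP/(_ (PSL2_of dB)); rewrite !in_setI PSL2_of_in.
rewrite (PSL2_of_class dA dB dP PA) andbT in_set1 /=.
have -> : PSL2_of dB \in 'C[PSL2_of dA]%g.
  by apply/cent1P/commute_sym/PSL2_of_commute; left.
move/esym/eqP/PSL2_of_eqP => [E|E]; first by rewrite E eqxx in neBA.
apply: tA; apply: (oppr_eq_self oddF).
by rewrite {1}(trace_conj dP PA) E raddfN.
Qed.

Lemma trace0_C5 A (dA : \det A = 1) : \tr A = 0 ->
  (PSL2_of dA ^: PSL2 F)%g = C5_nonsplit F.
Proof.
move=> tA; have [P dP PA] := trace0_conj oddF dA tA.
by apply/esym/class_eqP/(PSL2_of_class _ _ dP PA).
Qed.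

Lemma mem_C5 A (dA : \det A = 1) : (PSL2_of dA \in C5_nonsplit F) = (\tr A == 0).
Proof.
apply/idP/eqP => [/imsetP[_ /PSL2P[P [dP ->]]]|tA]; last first.
  by rewrite -(trace0_C5 dA tA) class_refl.
have tJ : \tr (mx2 0 (-1) 1 0 : 'M[F]_2) = 0 by rewrite trace_mx2 addr0.
move=> E; have : (PSL2_of dP * PSL2_of dA = PSL2_of (det_nonsplit F) * PSL2_of dP)%g.
  by rewrite E conjgE mulKVg.
rewrite !PSL2_ofM => /PSL2_of_eqP; rewrite -mulNr.
by case=> /(trace_conj dP) ->; rewrite ?raddfN /= tJ ?oppr0.
Qed.

Lemma card_pm1 : #|pm1 F| = 2%N.
Proof.
have N1 : (-1 : 'M[F]_2) \is a GRing.unit by rewrite unitrN unitr1.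
have -> : pm1 F = [set 1%g; FinRing.Unit N1].
  by apply/setP => g; rewrite !inE -!val_eqE.
rewrite cards2 -val_eqE /=; case: eqP => // /matrixP/(_ 0 0)/esym.
rewrite !mxE /= => /esym/(oppr_eq_self oddF)/eqP; by rewrite oner_eq0.
Qed.

(** For given a and b there is one solution c if b is not 0; if b = 0, every c or
    none is a solution, according to whether a^2 = -1. *)
Lemma card_trace0_triples :
  #|[set v : F * F * F | v.1.1 ^+ 2 + v.1.2 * v.2 == -1]|
    = (#|F| * #|F|.-1 + #|F| * #|[set i : F | (i ^+ 2 == -1)%R]|)%N.
Proof.
pose sol a b := [set c : F | a ^+ 2 + b * c == -1].
have sol0 a : #|sol a 0| = (#|F| * (a ^+ 2 == -1)%R)%N.
  have [a2|a2] := eqVneq (a ^+ 2) (-1).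
    rewrite muln1 -cardsT; congr #|pred_of_set _|.
    by apply/setP => c; rewrite !inE mul0r addr0 a2 eqxx.
  rewrite muln0 -(cards0 F); congr #|pred_of_set _|.
  by apply/setP => c; rewrite !inE mul0r addr0 (negbTE a2).
have sol1 a b : b != 0 -> #|sol a b| = 1%N.
  move=> b0; rewrite -(cards1 ((-1 - a ^+ 2) / b)); congr #|pred_of_set _|.
  apply/setP => c; rewrite !inE addrC -[RHS](inj_eq (mulfI b0)).
  by rewrite [b * (_ / b)]mulrC divfK // -[RHS](inj_eq (addIr (a ^+ 2))) subrK.
transitivity (\sum_(a : F) \sum_(b : F) #|sol a b|)%N.
  rewrite -sum1dep_card pair_big /=.
  rewrite (eq_bigr (fun p => \sum_(c : F | (p.1 ^+ 2 + p.2 * c == -1)%R) 1)%N)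
    => [|p _].
    by rewrite pair_big_dep.
  by rewrite sum1dep_card.
rewrite (eq_bigr (fun a => #|F|.-1 + #|F| * (a ^+ 2 == -1)%R)%N) => [|a _].
  rewrite big_split /= sum_nat_const -big_distrr /=; congr (_ + _ * _)%N.
  by rewrite -sum1dep_card [RHS]big_mkcond; apply: eq_bigr => a _; case: (_ == _).
rewrite (bigD1 0) //= sol0 addnC (eq_bigr (fun=> 1%N)) => [|b /sol1->//].
by rewrite sum1_card cardC1.
Qed.

(** A triple (a, b, c) gives the matrix with rows (a b) and (c -a), and each
    element of the class has two lifts. *)
Lemma card_C5_double :
  (#|C5_nonsplit F| * 2)%N =
    #|[set v : F * F * F | v.1.1 ^+ 2 + v.1.2 * v.2 == -1]|.
Proof.
pose T := [set g in SL2 F | \tr (GLval g) == 0].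
have TE : T = (coset (pm1 F) @^-1: C5_nonsplit F) :&: SL2 F.
  apply/setP => g; rewrite in_setI [RHS]andbC !inE; case: eqP => //= dg.
  by rewrite (coset_PSL2_of dg) mem_C5.
have <- : #|T| = (#|C5_nonsplit F| * 2)%N.
  have <- : [set coset (pm1 F) g | g in T] = C5_nonsplit F.
    apply/setP => k; apply/imsetP/idP => [[g]|C5k].
      by rewrite TE !inE => /andP[C5g _] ->.
    have /PSL2P[A [dA kE]] : k \in PSL2 F.
      by apply: subsetP k C5k; case: (C5_nonsplit_closed F).
    exists (FinRing.Unit (det1_unit dA)) => //.
    by rewrite TE inE inE -[coset _ _]/(PSL2_of dA) -kE C5k inE; apply/eqP.
  rewrite -[LHS]sum1_card (partition_big_imset (coset (pm1 F))) /= -sum_nat_const.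
  apply: eq_bigr => _ /imsetP[g Tg ->];
  rewrite sum1dep_card -[RHS]card_pm1 -[RHS](card_rcoset _ g).
  congr #|pred_of_set _|; apply/setP => h; rewrite inE.
  apply/andP/idP => [[_ /eqP]|hg].
    by move/(rcoset_kercosetP (pm1_norm h) (pm1_norm g)).
  have /(rcoset_kercosetP (pm1_norm h) (pm1_norm g)) hgE := hg.
  split; last exact/eqP.
  move: Tg; rewrite TE !in_setI !inE hgE => /andP[-> dg] /=.
  by case/coset_pm1P: hgE => ->; rewrite -?scaleN1r ?detZ ?sqrrN ?expr1n ?mul1r.
pose tr g := (GLval g 0 0, GLval g 0 1, GLval g 1 0).
rewrite -(@card_in_imset _ _ tr) => [|g h].
  congr #|pred_of_set _|; apply/setP => -[[a b] c]; apply/imsetP/idP; rewrite inE /=.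
    move=> [g]; rewrite inE inE => /andP[/eqP + /eqP +] [-> -> ->].
    rewrite [in \det _](mx2_eta (GLval g)) [in \tr _](mx2_eta (GLval g)).
    rewrite det_mx2 trace_mx2 => <- /eqP; rewrite addrC addr_eq0 => /eqP ->.
    by apply/eqP; ring.
  move=> /eqP abc; have dA : \det (mx2 a b c (- a)) = 1.
    by rewrite det_mx2; apply: oppr_inj; rewrite -abc; ring.
  exists (FinRing.Unit (det1_unit dA)); last by rewrite /tr /= !mxE.
  by rewrite inE inE /= dA trace_mx2 subrr !eqxx.
rewrite !inE => /andP[_ /eqP tg] /andP[_ /eqP th] [e1 e2 e3].
apply: val_inj; rewrite -[LHS]/(GLval g) -[RHS]/(GLval h).
move: tg th; rewrite [GLval g]mx2_eta [GLval h]mx2_eta !trace_mx2 e1 e2 e3.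
by move=> <- /addrI ->.
Qed.

End PSL2Elements.

(** * The classification *)

Section ConjIso.

Variables (gT : finGroupType) (G : {group gT}).

Lemma eq_Conj (C D : {set gT}) (cC : conj_closed G C) (cD : conj_closed G D) :
  C = D -> Conj G C cC = Conj G D cD.
Proof. by move=> E; subst D; congr Conj; exact: Prop_irrelevance. Qed.

Lemma quandle_iso_Conj_card (X : quandle) (C : {set gT}) (cC : conj_closed G C) n :
  #|C| = n -> quandle_iso X (Conj G C cC) -> has_card X n.
Proof.
move=> <- [f [[g fK gK] _]].
have E : #|{: {x | x \in C}}| = #|C| by rewrite card_sig.
exists (fun x => cast_ord E (enum_rank (f x))).
exists (fun i => g (enum_val (cast_ord (esym E) i))) => [x|i].
  by rewrite cast_ordK enum_rankK fK.
by rewrite gK enum_valK cast_ordKV.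
Qed.

End ConjIso.

Theorem theorem4p5 (p n q : nat) (p_prime : prime p) (p_odd : odd p)
    (qE : q = (p ^ n)%N) (q_gt9 : (9 < q)%N)
    (F : finFieldType) (cardF : #|F| = q)
    (X : quandle) (primX : primitive_quandle X)
    (innX : perm_isog (@Inn X) (PSL2 F)) :
  [/\ q = 1 %[mod 4],
      has_card X ((q * (q + 1)) %/ 2)
    & exists (i : F) (i2 : i ^+ 2 = -1),
        quandle_iso X
          (Conj (PSL2 F) (C5_split i2) (C5_split_closed i2))]
  \/
  [/\ q = 3 %[mod 4],
      has_card X ((q * (q - 1)) %/ 2)
    & quandle_iso X
        (Conj (PSL2 F) (C5_nonsplit F) (C5_nonsplit_closed F))].
Proof.
have oddq : odd q by rewrite qE oddX p_odd orbT.
have oddF : odd #|F| by rewrite cardF.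
have q_gt3 : (3 < #|F|)%N by rewrite cardF; apply: leq_trans q_gt9.
have [k [Gk [isoX k1 kC]]] := primitive_quandle_class primX innX (PSL2_nonabelian F).
have k2 : (k ^+ 2 = 1)%g.
  apply/eqP/negPn/negP => k2.
  have /eqP[] := PSL2_class_meets_cent1 oddF q_gt3 Gk k2.
  exact/kC/PSL2_abelian_cent1.
have C5E : (k ^: PSL2 F)%g = C5_nonsplit F.
  have [A [dA kE]] := PSL2P Gk.
  move: k1 k2; rewrite kE => k1 /(PSL2_sqr_eq1 k1); exact: trace0_C5.
rewrite (eq_Conj _ (C5_nonsplit_closed F) C5E) in isoX.
have cardC := card_C5_double oddF; rewrite card_trace0_triples cardF in cardC.
have q0 : (0 < q)%N by apply: leq_trans q_gt9.
have [q1|q1] := eqVneq (q %% 4)%N 1%N.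
  have [i i2] : exists i : F, i ^+ 2 = -1 by apply/neg1_square_mod4; rewrite // cardF.
  left; split=> //.
    apply: quandle_iso_Conj_card isoX; apply/eqP; rewrite eqn_div ?cardC; last 2 first.
    - by [].
    - by rewrite dvdn2 oddM oddD oddq.
    have -> : [set j : F | j ^+ 2 == -1] = [set i; - i].
      by apply/setP => j; rewrite !inE -i2 eqf_sqr.
    rewrite cards2.
    have -> : i != - i.
      apply: contra_eqN i2 => /eqP/(oppr_eq_self oddF) ->.
      by rewrite expr0n eq_sym oppr_eq0 oner_eq0.
    by rewrite -mulnDr -addSnnS prednK.
  exists i, i2.
  have dE : \tr (mx2 i 0 0 (- i)) = 0 by rewrite trace_mx2 subrr.
  by rewrite (eq_Conj _ (C5_nonsplit_closed F)) //; apply: trace0_C5.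
right; split=> //.
  move: q1 (ltn_pmod q (isT : 0 < 4)%N) (odd_mod q (erefl : odd 4 = false)).
  by rewrite oddq; case: (q %% 4)%N => [|[|[|[|]]]].
apply: quandle_iso_Conj_card isoX; apply/eqP; rewrite eqn_div ?cardC; last 2 first.
- by [].
- by rewrite dvdn2 oddM oddB // oddq.
have -> : [set j : F | j ^+ 2 == -1] = set0.
  apply/setP => j; rewrite !inE; apply: contra_neqF q1 => /eqP j2.
  by rewrite -cardF; apply/(neg1_square_mod4 oddF); exists j.
by rewrite cards0 muln0 addn0 subn1.
Qed.
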